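(* Let $q$ be a pure quaternion and let $\rho$ and $\theta$ be respectively the radius and the angle $\theta$ of the unique spherical representation $(\rho,\theta,\phi)$ of $q$. Then $$q\times_s^{(1,2)}q=\rho\,\big(\cos(\theta/2)+k\sin(\theta/2)\big)\,q\,\big(\cos(\theta/2)-k\sin(\theta/2)\big),$$ where the products on the right-hand side are the usual quaternion products.
   Context: $\mathbb{H}$ denotes the quaternions (with $i^2=j^2=k^2=ijk=-1$) and $\mathrm{Im}\,\mathbb{H}=\{ai+bj+ck : a,b,c\in\mathbb{R}\}$ the pure quaternions, with Euclidean norm $\|ai+bj+ck\|=\sqrt{a^2+b^2+c^2}$. Unique spherical representation: every $q\in\mathrm{Im}\,\mathbb{H}$ is written $q=\rho(i\sin\phi\cos\theta+j\sin\phi\sin\theta+k\cos\phi)$ with $\rho=\|q\|\ge 0$, $0\le\theta<2\pi$, $0\le\phi\le\pi$; the triple $(\rho,\theta,\phi)$ is made unique by the conventions: for $q=0$ take $\theta=\phi=0$; for $q=ck$ with $c>0$ take $(c,0,0)$; for $q=ck$ with $c<0$ take $(|c|,0,\pi)$. For this representation, define $$q\times_s^{(1,2)}q:=\rho^2\big(i\sin(\phi)\cos(2\theta)+j\sin(\phi)\sin(2\theta)+k\cos(\phi)\big).$$ *)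

(* Defs.v *)
From HB Require Import structures.
From mathcomp Require Import all_boot all_order all_algebra.
From mathcomp Require Import all_classical all_reals all_analysis.
From mathcomp Require Import ring lra.

Set Implicit Arguments.
Unset Strict Implicit.
Unset Printing Implicit Defensive.

Import Order.TTheory GRing.Theory Num.Theory.
Local Open Scope ring_scope.

Record quat (R : realType) := Quat { qre : R; qi : R; qj : R; qk : R }.

Section QuaternionAlgebra.
Variable R : realType.
Implicit Types p q : quat R.

Definition tuple_of_quat q := (qre q, qi q, qj q, qk q).
Definition quat_of_tuple (t : R * R * R * R) :=
  let: (a, b, c, d) := t in Quat a b c d.
Lemma tuple_of_quatK : cancel tuple_of_quat quat_of_tuple.
Proof. by case. Qed.

HB.instance Definition _ := Choice.copy (quat R) (can_type tuple_of_quatK).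

Definition addq p q :=
  Quat (qre p + qre q) (qi p + qi q) (qj p + qj q) (qk p + qk q).
Definition oppq p := Quat (- qre p) (- qi p) (- qj p) (- qk p).

Definition mulq p q :=
  Quat (qre p * qre q - qi p * qi q - qj p * qj q - qk p * qk q)
       (qre p * qi q + qi p * qre q + qj p * qk q - qk p * qj q)
       (qre p * qj q - qi p * qk q + qj p * qre q + qk p * qi q)
       (qre p * qk q + qi p * qj q - qj p * qi q + qk p * qre q).
Definition scaleq (a : R) q := Quat (a * qre q) (a * qi q) (a * qj q) (a * qk q).

Fact addqA : associative addq.
Proof. by move=> [????] [????] [????]; congr Quat => /=; ring. Qed.
Fact addqC : commutative addq.
Proof. by move=> [????] [????]; congr Quat => /=; ring. Qed.
Fact add0q : left_id (Quat 0 0 0 0) addq.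
Proof. by move=> [????]; congr Quat => /=; ring. Qed.
Fact addNq : left_inverse (Quat 0 0 0 0) oppq addq.
Proof. by move=> [????]; congr Quat => /=; ring. Qed.
HB.instance Definition _ := GRing.isZmodule.Build (quat R) addqA addqC add0q addNq.

Fact mulqA : associative mulq.
Proof. by move=> [????] [????] [????]; congr Quat => /=; ring. Qed.
Fact mul1q : left_id (Quat 1 0 0 0) mulq.
Proof. by move=> [????]; congr Quat => /=; ring. Qed.
Fact mulq1 : right_id (Quat 1 0 0 0) mulq.
Proof. by move=> [????]; congr Quat => /=; ring. Qed.
Fact mulqDl : left_distributive mulq +%R.
Proof. by move=> [????] [????] [????]; congr Quat => /=; ring. Qed.
Fact mulqDr : right_distributive mulq +%R.
Proof. by move=> [????] [????] [????]; congr Quat => /=; ring. Qed.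
Fact oneq_neq0 : Quat 1 0 0 0 != 0 :> quat R.
Proof. by apply/eqP => -[/eqP]; rewrite oner_eq0. Qed.
HB.instance Definition _ := GRing.Zmodule_isNzRing.Build (quat R)
  mulqA mul1q mulq1 mulqDl mulqDr oneq_neq0.

Fact scaleqA a b q : scaleq a (scaleq b q) = scaleq (a * b) q.
Proof. by case: q => ????; congr Quat => /=; ring. Qed.
Fact scale1q : left_id 1 scaleq.
Proof. by move=> [????]; congr Quat => /=; ring. Qed.
Fact scaleqDr : right_distributive scaleq +%R.
Proof. by move=> ? [????] [????]; congr Quat => /=; ring. Qed.
Fact scaleqDl q : {morph scaleq^~ q : a b / a + b}.
Proof. by case: q => ???? ??; congr Quat => /=; ring. Qed.
HB.instance Definition _ := GRing.Zmodule_isLmodule.Build R (quat R)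
  scaleqA scale1q scaleqDr scaleqDl.

Fact scaleqAl (a : R) p q : a *: (p * q) = (a *: p) * q.
Proof. by case: p q => ???? [????]; congr Quat => /=; ring. Qed.
HB.instance Definition _ := GRing.Lmodule_isLalgebra.Build R (quat R) scaleqAl.

Fact scaleqAr (a : R) p q : a *: (p * q) = p * (a *: q).
Proof. by case: p q => ???? [????]; congr Quat => /=; ring. Qed.
HB.instance Definition _ := GRing.Lalgebra_isAlgebra.Build R (quat R) scaleqAr.

End QuaternionAlgebra.

Definition uI {R : realType} : quat R := Quat 0 1 0 0.
Definition uJ {R : realType} : quat R := Quat 0 0 1 0.
Definition uK {R : realType} : quat R := Quat 0 0 0 1.

Lemma hamilton_relations (R : realType) :
  [/\ (uI : quat R) ^+ 2 = -1, (uJ : quat R) ^+ 2 = -1,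
      (uK : quat R) ^+ 2 = -1 & (uI : quat R) * uJ * uK = -1].
Proof. by rewrite !expr2; split; congr Quat => /=; ring. Qed.

Definition pure_quat {R : realType} (q : quat R) : Prop :=
  exists a b c : R, q = a *: uI + b *: uJ + c *: uK.

Definition qnorm {R : realType} (q : quat R) : R :=
  Num.sqrt (qre q ^+ 2 + qi q ^+ 2 + qj q ^+ 2 + qk q ^+ 2).

Section Spherical.
Variable R : realType.
Implicit Types (q : quat R) (rho theta phi : R).

Definition of_spherical rho theta phi : quat R :=
  rho *: ((sin phi * cos theta) *: uI + (sin phi * sin theta) *: uJ
          + cos phi *: uK).

(* The last three clauses make the triple unique when q lies on the k-axis. *)
Definition spherical_repr q (t : R * R * R) : Prop :=
  let: (rho, theta, phi) := t in
  [/\ rho = qnorm q, 0 <= theta < 2 * pi, 0 <= phi <= pi,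
      q = of_spherical rho theta phi
    & [/\ q = 0 -> theta = 0 /\ phi = 0,
          forall c : R, 0 < c -> q = c *: uK ->
            (rho, theta, phi) = (c, 0, 0)
        & forall c : R, c < 0 -> q = c *: uK ->
            (rho, theta, phi) = (`|c|, 0, pi)]].

Lemma coordsE (a b c : R) : a *: uI + b *: uJ + c *: uK = Quat 0 a b c.
Proof. by congr Quat => /=; ring. Qed.

Lemma of_sphericalE rho theta phi : of_spherical rho theta phi =
  Quat 0 (rho * (sin phi * cos theta)) (rho * (sin phi * sin theta))
       (rho * cos phi).
Proof. by rewrite /of_spherical coordsE; congr Quat => /=; ring. Qed.

Lemma scale_uK (c : R) : c *: uK = Quat 0 0 0 c.
Proof. by congr Quat => /=; ring. Qed.

Lemma circle_angle_exists (x y : R) : x ^+ 2 + y ^+ 2 = 1 ->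
  exists2 theta, 0 <= theta < 2 * pi & cos theta = x /\ sin theta = y.
Proof.
move=> xy1; have pi0 := pi_gt0 R.
have x11 : -1 <= x <= 1 by apply/andP; split; nra.
have xI : x \in `[(-1), 1] by rewrite in_itv.
have sq : Num.sqrt (1 - x ^+ 2) = `|y|.
  by rewrite -sqrtr_sqr; congr Num.sqrt; lra.
have [y0|y0] := lerP 0 y.
  exists (acos x).
    by rewrite acos_ge0//=; have := acos_lepi x11; lra.
  by rewrite acosK// sin_acos// sq ger0_norm.
exists (2 * pi - acos x).
  have x1 : -1 <= x < 1 by apply/andP; split; nra.
  by have := acos_gt0 x1; have := acos_lepi x11; lra.
have -> : 2 * pi - acos x = - acos x + pi *+ 2 by rewrite mulr2n; ring.
rewrite cosD2pi sinD2pi cosN sinN acosK// sin_acos// sq ltr0_norm//.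
by rewrite opprK.
Qed.

Lemma circle_angle_inj (t u : R) : 0 <= t < 2 * pi -> 0 <= u < 2 * pi ->
  cos t = cos u -> sin t = sin u -> t = u.
Proof.
have sin_neg (x : R) : pi < x < 2 * pi -> sin x < 0.
  move=> x12; have -> : x = (x - pi) + pi by ring.
  by rewrite sinDpi oppr_lt0 sin_gt0_pi//; lra.
have cos_refl (x : R) : cos (2 * pi - x) = cos x.
  have -> : 2 * pi - x = - x + pi *+ 2 by rewrite mulr2n; ring.
  by rewrite cosD2pi cosN.
move=> t02 u02 ctu stu.
have [tpi|tpi] := lerP t pi; have [upi|upi] := lerP u pi.
- by apply: (@cos_inj R) => //; rewrite in_itv /=; lra.
- have := sin_neg u; have /sin_ge0_pi : 0 <= t <= pi by lra.
  by rewrite stu => ? /(_ _); lra.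
- have := sin_neg t; have /sin_ge0_pi : 0 <= u <= pi by lra.
  by rewrite stu => ? /(_ _); lra.
- have : 2 * pi - t = 2 * pi - u; last by lra.
  by apply: (@cos_inj R); rewrite ?cos_refl// in_itv /=; lra.
Qed.

Lemma spherical_repr_exists q : pure_quat q -> exists t, spherical_repr q t.
Proof.
move=> [a [b [c ->]]]; rewrite coordsE; have pi0 := pi_gt0 R.
have nE : qnorm (Quat 0 a b c) = Num.sqrt (a ^+ 2 + b ^+ 2 + c ^+ 2).
  by rewrite /qnorm /=; congr Num.sqrt; ring.
have [/andP[/eqP a0 /eqP b0]|ab0] := boolP ((a == 0) && (b == 0)).
  have nc : qnorm (Quat 0 a b c) = `|c|.
    by rewrite nE a0 b0 expr0n /= !add0r sqrtr_sqr.
  have [c0|c0] := lerP 0 c.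
    exists (`|c|, 0, 0); split; rewrite ?nc //; [lra|lra| |].
      by rewrite of_sphericalE sin0 cos0 a0 b0 ger0_norm//; congr Quat; ring.
    split=> // d d0; rewrite scale_uK => -[_ _ cd]; first by rewrite cd gtr0_norm.
    by exfalso; lra.
  exists (`|c|, 0, pi); split; rewrite ?nc //; [lra|lra| |].
    by rewrite of_sphericalE sinpi cospi a0 b0 ltr0_norm//; congr Quat; ring.
  split=> [[_ _ cz]|d d0|d d0]; rewrite ?scale_uK; first by exfalso; lra.
    by case=> _ _ cd; exfalso; lra.
  by case=> _ _ ->.
have s0 : 0 < a ^+ 2 + b ^+ 2.
  rewrite lt_neqAle eq_sym paddr_eq0 ?sqr_ge0// !sqrf_eq0 ab0 /=.
  by rewrite addr_ge0 ?sqr_ge0.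
set s := Num.sqrt (a ^+ 2 + b ^+ 2).
have sp : 0 < s by rewrite sqrtr_gt0.
have s2 : s ^+ 2 = a ^+ 2 + b ^+ 2 by rewrite sqr_sqrtr// ltW.
set r := qnorm (Quat 0 a b c).
have rp : 0 < r by rewrite /r nE sqrtr_gt0; have := sqr_ge0 c; lra.
have r2 : r ^+ 2 = a ^+ 2 + b ^+ 2 + c ^+ 2.
  by rewrite /r nE sqr_sqrtr//; have := sqr_ge0 c; lra.
have [theta theta02 [ct st]] : exists2 theta, 0 <= theta < 2 * pi &
    cos theta = a / s /\ sin theta = b / s.
  apply: circle_angle_exists; rewrite !expr_div_n -mulrDl -s2 divff//.
  by rewrite expf_neq0// gt_eqF.
have cr2 : (c / r) ^+ 2 + (s / r) ^+ 2 = 1.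
  rewrite !expr_div_n -mulrDl s2 addrC -r2 divff//.
  by rewrite expf_neq0// gt_eqF.
have sr0 : 0 <= s / r by rewrite divr_ge0 ?ltW.
have cr11 : -1 <= c / r <= 1 by apply/andP; split; nra.
exists (r, theta, acos (c / r)); split=> //.
- by rewrite acos_ge0// acos_lepi.
- rewrite of_sphericalE ct st acosK ?in_itv// sin_acos//.
  have -> : Num.sqrt (1 - (c / r) ^+ 2) = s / r.
    by rewrite -[RHS]ger0_norm// -sqrtr_sqr; congr Num.sqrt; lra.
  by congr Quat; field; rewrite ?gt_eqF.
- have nk d : Quat 0 a b c <> Quat 0 0 0 d.
    by case=> a0 b0 _; rewrite a0 b0 !eqxx in ab0.
  by split=> [/nk //|d _|d _]; rewrite scale_uK => /nk.
Qed.

Lemma spherical_repr_unique q t u :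
  spherical_repr q t -> spherical_repr q u -> t = u.
Proof.
move: t u => [[r t] f] [[r' u] g] /= [rE t02 f0pi qE [tz tp tn]].
move=> [r'E u02 g0pi qE' [uz up un]].
have rr' : r' = r by rewrite rE r'E.
have : of_spherical r t f = of_spherical r u g by rewrite -qE qE' rr'.
rewrite !of_sphericalE => -[Ei Ej Ek].
have [r0|r0] := eqVneq r 0.
  have q0 : q = 0 by rewrite qE r0 /of_spherical scale0r.
  by have [-> ->] := tz q0; have [-> ->] := uz q0; rewrite rr'.
have fg : f = g.
  by apply: (@cos_inj R); rewrite ?in_itv//=; apply: (mulfI r0).
have rp : 0 < r by rewrite lt_neqAle eq_sym r0 rE sqrtr_ge0.
have [sf0|sf0] := eqVneq (sin f) 0.
  have qk : q = (r * cos f) *: uK.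
    by rewrite qE of_sphericalE sf0 scale_uK; congr Quat; ring.
  have cf0 : cos f != 0.
    apply/eqP => cf0; have := cos2Dsin2 f; rewrite sf0 cf0.
    by move/eqP; rewrite expr0n /= addr0 eq_sym oner_eq0.
  have [c0|c0|/eqP] := ltrgtP (r * cos f) 0.
  - by rewrite (tn _ c0 qk) (un _ c0 qk).
  - by rewrite (tp _ c0 qk) (up _ c0 qk).
  - by rewrite mulf_eq0 (negbTE r0) (negbTE cf0).
rewrite rr' -fg; congr (_, _, _); rewrite -fg in Ei Ej.
by apply: circle_angle_inj => //; apply: (mulfI sf0); apply: (mulfI r0).
Qed.

(* The (0, 0, 0) default is reached only for q that are not pure. *)
Definition spherical_coords q : R * R * R :=
  xget (0, 0, 0) [set t | spherical_repr q t]%classic.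

Lemma spherical_coordsP q :
  pure_quat q -> spherical_repr q (spherical_coords q).
Proof. by move=> /spherical_repr_exists; exact: xgetPex. Qed.

(* The spherical product [q \times_s^{(1,2)} q] of a pure q with itself: the
   radius is squared, theta doubled and phi kept. *)
Definition sph_square12 q : quat R :=
  let: (rho, theta, phi) := spherical_coords q in
  rho ^+ 2 *: ((sin phi * cos (2 * theta)) *: uI
               + (sin phi * sin (2 * theta)) *: uJ + cos phi *: uK).

End Spherical.

(* Main.v *)
(* Conjugation by cos(theta/2) + k sin(theta/2) rotates the pure quaternions
   about the k-axis by the angle theta, which adds theta to the azimuth and keeps
   rho and phi. *)
Require Import Defs.
From mathcomp Require Import all_boot all_order all_algebra.
From mathcomp Require Import all_classical all_reals all_analysis.
From mathcomp Require Import ring.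

Set Implicit Arguments.
Unset Strict Implicit.
Unset Printing Implicit Defensive.

Import Order.TTheory GRing.Theory Num.Theory.
Local Open Scope ring_scope.

(** Rotating [q] by its own azimuth [theta] doubles that azimuth, and the outer factor [rho] squares
    the radius. [conj_uK] computes the rotation in coordinates from the half-angle formulas;
    [conj_uK_of_spherical] reads it as a shift of the azimuth. *)

Lemma conj_uK (R : realType) (t x y z : R) :
  ((cos (t / 2))%:A + sin (t / 2) *: uK) * Quat 0 x y z
    * ((cos (t / 2))%:A - sin (t / 2) *: uK) =
  Quat 0 (x * cos t - y * sin t) (x * sin t + y * cos t) z.
Proof.
have tE : t = t / 2 + t / 2 by field.
have ct : cos t = cos (t / 2) ^+ 2 - sin (t / 2) ^+ 2.
  by rewrite [in LHS]tE cosD !expr2.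
have st : sin t = 2 * (sin (t / 2) * cos (t / 2)).
  by rewrite [in LHS]tE sinD; ring.
(* The conjugation multiplies the k-coordinate by this sum of squares; spelling it out leaves [ring]
   a polynomial identity. *)
have zE : z = z * (cos (t / 2) ^+ 2 + sin (t / 2) ^+ 2).
  by rewrite cos2Dsin2 mulr1.
by rewrite ct st [in RHS]zE; congr Quat => /=; ring.
Qed.

Lemma conj_uK_of_spherical (R : realType) (t rho theta phi : R) :
  ((cos (t / 2))%:A + sin (t / 2) *: uK) * of_spherical rho theta phi
    * ((cos (t / 2))%:A - sin (t / 2) *: uK) =
  of_spherical rho (theta + t) phi.
Proof.
by rewrite !of_sphericalE conj_uK cosD sinD; congr Quat; ring.
Qed.

Theorem theorem14 (R : realType) (q : quat R) (rho theta phi : R)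
    (q_pure : pure_quat q) (q_sph : spherical_repr q (rho, theta, phi)) :
  sph_square12 q =
    rho *: (((cos (theta / 2))%:A + sin (theta / 2) *: uK) * q
            * ((cos (theta / 2))%:A - sin (theta / 2) *: uK)).
Proof.
rewrite /sph_square12.
(* [spherical_coords] is a choice; uniqueness identifies its value with the given triple. *)
rewrite (spherical_repr_unique (spherical_coordsP q_pure) q_sph).
case: q_sph => _ _ _ -> _; rewrite conj_uK_of_spherical.
by rewrite /of_spherical scalerA -expr2 mulr_natl mulr2n.
Qed.
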